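(* There exist universal constants $\beta>0$ and $c>1$ such that the following holds for all sufficiently large $\ell$ and $\ell'$, every $\epsilon>0$, every $t\le 2^{\ell/5}$ and every $\rho\ge 2^{-\ell/3}$. If $(\operatorname{Con},\operatorname{Red})$ is a nonuniform black-box proof for hard-core predicates for hard-to-compute functions with parameters $\ell,\ell',\rho,\epsilon$ that uses $q$ queries and $t$ bits of advice, then \[ q\ \ge\ \frac{1}{\epsilon^{\beta}}-c\,(t+\ell). \]
   Context: $U_m$ denotes the uniform distribution on $\{0,1\}^m$. A pair $(\operatorname{Con},\operatorname{Red})$ is a nonuniform black-box proof for hard-core predicates for hard-to-compute functions with parameters $\ell,\ell',\rho,\epsilon$, that uses $q$ queries and $t$ bits of advice, if: $\operatorname{Con}$ is an arbitrary map (no efficiency requirement) that given any function $g:\{0,1\}^\ell\to\{0,1\}^\ell$ produces a function $g^{\mathrm{pred}}=\operatorname{Con}(g):\{0,1\}^{\ell'}\to\{0,1\}$; $\operatorname{Red}$ is an oracle procedure (of arbitrary complexity) that, given oracle access to a function $h:\{0,1\}^{\ell'}\to\{0,1\}$ and inputs $x\in\{0,1\}^\ell$, $\alpha\in\{0,1\}^t$, makes at most $q$ queries to its oracle and outputs an element of $\{0,1\}^\ell$; and for all functions $g:\{0,1\}^\ell\to\{0,1\}^\ell$ and $h:\{0,1\}^{\ell'}\to\{0,1\}$ with $\Pr_{x\leftarrow U_{\ell'}}[h(x)=g^{\mathrm{pred}}(x)]\ge\frac12+\epsilon$, there exists $\alpha\in\{0,1\}^t$ such that $\Pr_{x\leftarrow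 U_\ell}[\operatorname{Red}^h(x,\alpha)=g(x)]\ge\rho$. *)

(* Defs.v *)
From HB Require Import structures.
From mathcomp Require Import all_boot all_order all_algebra.
From mathcomp Require Import reals exp.

Set Implicit Arguments.
Unset Strict Implicit.
Unset Printing Implicit Defensive.

Import Order.TTheory GRing.Theory Num.Theory.
Local Open Scope ring_scope.

Notation bits m := (m.-tuple bool).

Definition prU (R : realType) (m : nat) (E : pred (bits m)) : R :=
  #|E|%:R / #|{: bits m}|%:R.

(* A deterministic, adaptive oracle procedure of unrestricted complexity: the
   next query, or the output, depends arbitrarily on the answers so far. *)
Inductive oracle_proc (Q A : Type) : Type :=
| Output of A
| Query of Q & (bool -> oracle_proc Q A).

Arguments Output {Q A} _.
Arguments Query {Q A} _ _.

Fixpoint run (Q A : Type) (h : Q -> bool) (p : oracle_proc Q A) : A :=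
  match p with
  | Output a => a
  | Query z k => run h (k (h z))
  end.

Fixpoint nqueries (Q A : Type) (h : Q -> bool) (p : oracle_proc Q A) : nat :=
  match p with
  | Output _ => 0%N
  | Query z k => (nqueries h (k (h z))).+1
  end.

Definition construction (l l' : nat) : Type :=
  (bits l -> bits l) -> (bits l' -> bool).

Definition reduction (l l' t : nat) : Type :=
  bits l -> bits t -> oracle_proc (bits l') (bits l).

Definition hardcore_bb_proof (R : realType) (l l' : nat) (rho eps : R)
    (q t : nat) (Con : construction l l') (Red : reduction l l' t) : Prop :=
  (forall (h : bits l' -> bool) (x : bits l) (a : bits t),
     (nqueries h (Red x a) <= q)%N)
  /\
  (forall (g : bits l -> bits l) (h : bits l' -> bool),
     2^-1 + eps <= prU R [pred x | h x == Con g x] ->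
     exists a : bits t, rho <= prU R [pred x | run h (Red x a) == g x]).

(* Main.v *)
Require Import Defs.
From HB Require Import structures.
From mathcomp Require Import all_boot all_order all_algebra.
From mathcomp Require Import reals exp.
From mathcomp Require Import zify ring lra.

Set Implicit Arguments.
Unset Strict Implicit.
Unset Printing Implicit Defensive.

Import Order.TTheory GRing.Theory Num.Theory.
Local Open Scope ring_scope.

(** Take [beta = 1/2] and [c = 2], draw [g] at random and let [h] agree with
    [Con g] at each point independently with probability [(1 + d) / 2]; here
    [d = 4 sqrt eps] when [eps 2^l' >= 1] and [d = 0] otherwise, so that [h] is
    [1/2 + eps]-close to [Con g] with probability at least [1/4].  Hence some
    advice [a] and some set [S] of [s] inputs, [s] about [2^(2l/3)], satisfy
    [Red^h(x, a) = g x] on all of [S].  For fixed [a] and [S] this event reads at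
    most [s q] bits of [h], so replacing [h] by a uniform function independent of
    [g] changes its probability by a factor at most [(1 + d)^(s q)], which is
    [2^(O(s))] once [q sqrt eps <= 1]; for the independent pair it is [2^(- l s)].
    A union bound over [a] and [S] contradicts the lower bound [1/4]. *)

(** * Product measures on oracles and change of measure *)

Section ProductWeights.
Variables (R : realType) (Q : finType).
Implicit Types (w u : Q -> bool -> R) (h : {ffun Q -> bool}).

Definition weight w h : R := \prod_z w z (h z).

(** Conditioning on [h z = b] without renormalising: the restricted measure is again a product, so
    an induction over queries stays among product weights. *)
Definition pin w z b : Q -> bool -> R :=
  fun z' b' => if z' == z then (if b' == b then w z b else 0) else w z' b'.

Lemma weight_ge0 w h : (forall z b, 0 <= w z b) -> 0 <= weight w h.
Proof. by move=> w0; apply: prodr_ge0. Qed.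

Lemma sum_weight w : \sum_h weight w h = \prod_z (w z true + w z false).
Proof.
rewrite -(bigA_distr_bigA w); apply: eq_bigr => z _.
by rewrite big_bool.
Qed.

Lemma weight_pin w z b h :
  weight (pin w z b) h = if h z == b then weight w h else 0.
Proof.
rewrite /weight (bigD1 z) //= {1}/pin eqxx.
have [hz|hz] := eqVneq (h z) b; last by rewrite mul0r.
rewrite [RHS](bigD1 z) //= hz; congr (_ * _); apply: eq_bigr => y yz.
by rewrite /pin (negPf yz).
Qed.

Lemma sum_pin w z (F : {ffun Q -> bool} -> R) :
  \sum_h weight w h * F h = \sum_b \sum_h weight (pin w z b) h * F h.
Proof.
rewrite exchange_big; apply: eq_bigr => h _ /=.
by rewrite big_bool !weight_pin; case: (h z) => /=; rewrite mul0r ?addr0 ?add0r.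
Qed.

(* Each query multiplies the likelihood ratio between the two product measures
   by at most [K]; a point that was already queried carries equal weights. *)
Lemma run_change_of_measure (A : Type) (p : oracle_proc Q A) (f : A -> R)
    (K : R) w u :
  1 <= K -> (forall a, 0 <= f a) ->
  (forall z b, 0 <= w z b <= K * u z b) ->
  (forall z, w z true + w z false = u z true + u z false) ->
  \sum_h weight w h * f (run h p) <=
  \sum_h weight u h * (K ^+ nqueries h p * f (run h p)).
Proof.
move=> K1 f0; have Kgt0 : 0 < K by lra.
elim: p w u => [a|z k IH] w u wu mass /=.
  under [leRHS]eq_bigr do rewrite expr0 mul1r.
  rewrite -!big_distrl /= !sum_weight ler_wpM2r //.
  by under eq_bigr do rewrite mass.
have u0 y b : 0 <= u y b.
  by have /andP[h1 h2] := wu y b; rewrite -(pmulr_rge0 _ Kgt0); apply: le_trans h2.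
rewrite (sum_pin w z) (sum_pin u z); apply: ler_sum => b _.
(* [pin w z b] and [pin u z b] may differ in mass at [z], which the induction hypothesis forbids.
   Replacing [w z b] by [u z b] at [z] alone costs the factor [K] of this query and restores equal
   masses. *)
pose w' y b' := if y == z then pin u z b y b' else w y b'.
have pin0 y b' : 0 <= pin u z b y b' by rewrite /pin; do 2?case: ifP.
have w'0 y b' : 0 <= w' y b'.
  by rewrite /w'; case: ifP => // _; case/andP: (wu y b').
have step h : weight (pin w z b) h * f (run h (k (h z))) <=
    K * (weight w' h * f (run h (k b))).
  rewrite weight_pin; have [hz|hz] := eqVneq (h z) b; last first.
    by rewrite mul0r !mulr_ge0 ?weight_ge0 // ltW.
  rewrite hz mulrA ler_wpM2r // /weight (bigD1 z) //=.
  rewrite [X in _ <= _ * X](bigD1 z) //= mulrA; apply: ler_pM.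
  - by case/andP: (wu z (h z)).
  - by apply: prodr_ge0 => y _; case/andP: (wu y (h y)).
  - by rewrite /w' eqxx /pin eqxx hz eqxx; case/andP: (wu z b).
  - rewrite le_eqVlt; apply/orP; left; apply/eqP/eq_bigr => y yz.
    by rewrite /w' (negPf yz).
apply: (@le_trans _ _ (\sum_h K * (weight w' h * f (run h (k b))))).
  by apply: ler_sum => h _.
rewrite -big_distrr /=.
apply: le_trans (ler_wpM2l (ltW Kgt0) (IH b w' (pin u z b) _ _)) _.
- move=> y b'; rewrite w'0 /=; rewrite /w' /pin; have [_|_] := eqVneq y z.
    case: (b' == b); last by rewrite mulr0.
    by rewrite ler_peMl.
  by case/andP: (wu y b').
- by move=> y; rewrite /w'; case: ifP => // yz; rewrite /pin yz mass.
rewrite big_distrr /= le_eqVlt; apply/orP; left; apply/eqP/eq_bigr => h _.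
rewrite weight_pin; have [->|hz] := eqVneq (h z) b; last by rewrite !mul0r mulr0.
by rewrite exprS; ring.
Qed.

End ProductWeights.

(** * Sequential composition of oracle procedures *)

Section Conjunction.
Variables (Q A X : Type).

Fixpoint bind_proc (B : Type) (p : oracle_proc Q A)
    (k : A -> oracle_proc Q B) : oracle_proc Q B :=
  match p with
  | Output a => k a
  | Query z c => Query z (fun b => bind_proc (c b) k)
  end.

Lemma run_bind (B : Type) h (p : oracle_proc Q A) (k : A -> oracle_proc Q B) :
  run h (bind_proc p k) = run h (k (run h p)).
Proof. by elim: p => //= z c IH. Qed.

Lemma nqueries_bind (B : Type) h (p : oracle_proc Q A)
    (k : A -> oracle_proc Q B) :
  nqueries h (bind_proc p k) = (nqueries h p + nqueries h (k (run h p)))%N.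
Proof. by elim: p => //= z c ->. Qed.

(** Success on a whole set of inputs becomes the output of one adaptive procedure, to which the
    change of measure applies directly. *)
Fixpoint all_proc (P : X -> A -> bool) (p : X -> oracle_proc Q A) (s : seq X) :
    oracle_proc Q bool :=
  if s is x :: s' then
    bind_proc (p x) (fun a => if P x a then all_proc P p s' else Output false)
  else Output true.

Lemma run_all_proc P p s h :
  run h (all_proc P p s) = all (fun x => P x (run h (p x))) s.
Proof. by elim: s => //= x s <-; rewrite run_bind; case: (P x _). Qed.

Lemma nqueries_all_proc P p s h q :
  (forall x, nqueries h (p x) <= q)%N ->
  (nqueries h (all_proc P p s) <= size s * q)%N.
Proof.
move=> hq; elim: s => //= x s IH; rewrite nqueries_bind mulSn leq_add //.
by case: (P x _).
Qed.

End Conjunction.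

(** * Noisy copies of a predicate and their agreement with it *)

Section Noise.
Variables (R : realType) (Q : finType).
Implicit Types (c : Q -> bool) (h : {ffun Q -> bool}) (d : R).

Definition agree c h : nat := #|[pred z | h z == c z]|.

Definition agree_sign c z b : R := if b == c z then 1 else -1.

Definition noisy d c : Q -> bool -> R :=
  fun z b => (1 + d * agree_sign c z b) / 2.

Lemma noisy_ge0 d c z b : 0 <= d <= 1 -> 0 <= noisy d c z b.
Proof. by rewrite /noisy /agree_sign => /andP[? ?]; case: ifP => _; lra. Qed.

Lemma noisy_le d c z b : 0 <= d -> noisy d c z b <= (1 + d) * 2^-1.
Proof. by rewrite /noisy /agree_sign; case: ifP => _ ?; lra. Qed.

Lemma noisy_mass d c z : noisy d c z true + noisy d c z false = 1.
Proof. by rewrite /noisy /agree_sign; case: (c z) => /=; field. Qed.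

Lemma sum_noisy d c : \sum_h weight (noisy d c) h = 1.
Proof. by rewrite sum_weight big1 // => z _; rewrite noisy_mass. Qed.

Lemma sum_agree_sign c h :
  \sum_z agree_sign c z (h z) = 2 * (agree c h)%:R - #|Q|%:R.
Proof.
rewrite /agree -!sum1_card !natr_sum big_distrr /= [X in X - _]big_mkcond /=.
rewrite -sumrB; apply: eq_bigr => z _; rewrite inE /agree_sign /=.
by case: ifP => _; ring.
Qed.

Lemma weightM (w v : Q -> bool -> R) h :
  weight w h * weight v h = weight (fun z b => w z b * v z b) h.
Proof. by rewrite /weight -big_split. Qed.

(** A function of one bit is put in product form so that [sum_weight] evaluates its expectation. *)
Lemma weight_coord (y : bool -> R) i h :
  weight (fun z b => if z == i then y b else 1) h = y (h i).
Proof. by rewrite /weight -big_mkcond /= big_pred1_eq. Qed.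

(** The signs are independent with mean [d]: cross terms vanish, and each diagonal term is
    [1 - d ^+ 2]. *)
Lemma noisy_variance d c :
  \sum_h weight (noisy d c) h * (\sum_z (agree_sign c z (h z) - d)) ^+ 2 <=
  #|Q|%:R.
Proof.
under eq_bigr do rewrite expr2 big_distrlr /= big_distrr /=.
under eq_bigr do under eq_bigr do rewrite big_distrr /=.
rewrite exchange_big /= -sum1_card natr_sum; apply: ler_sum => i _.
rewrite exchange_big (bigD1 i) //= [X in _ + X]big1 ?addr0 => [|j ji].
  under eq_bigr => h _ do
    rewrite -(weight_coord (fun b => (agree_sign c i b - d)
      * (agree_sign c i b - d)) i) weightM.
  rewrite sum_weight (bigD1 i) //= big1 => [|z /negPf ->]; last first.
    by rewrite !mulr1 noisy_mass.
  rewrite eqxx /noisy /agree_sign; have := sqr_ge0 d.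
  by case: (c i) => /=; lra.
under eq_bigr => h _ do
  rewrite -(weight_coord (fun b => agree_sign c i b - d) i)
    -(weight_coord (fun b => agree_sign c j b - d) j) !weightM.
rewrite eq_sym in ji; rewrite sum_weight (bigD1 i) //= eqxx (negPf ji).
rewrite [X in X * _](_ : _ = 0) ?mul0r // /noisy /agree_sign.
by case: (c i) => /=; field.
Qed.

(* Chebyshev: with bias [4 r] and [1 <= r ^+ 2 * #|Q|], missing the agreement
   [1/2 + r ^+ 2] is a deviation by at least two standard deviations. *)
Lemma noisy_agree_ge (r : R) c :
  0 <= r <= 4^-1 -> 1 <= r ^+ 2 * #|Q|%:R ->
  4^-1 <= \sum_(h | (2^-1 + r ^+ 2) * #|Q|%:R <= (agree c h)%:R)
            weight (noisy (4 * r) c) h.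
Proof.
move=> /andP[r0 r1] rM; set M : R := #|Q|%:R in rM *.
set w := noisy _ c; pose G h := (2^-1 + r ^+ 2) * M <= (agree c h)%:R.
have w0 h : 0 <= weight w h by apply: weight_ge0 => z b; apply: noisy_ge0; lra.
have M0 : 0 < M.
  rewrite lt_neqAle ler0n andbT; apply/eqP => M0; move: rM; rewrite -M0; lra.
have tot : \sum_(h | G h) weight w h + \sum_(h | ~~ G h) weight w h = 1.
  by rewrite -(sum_noisy (4 * r) c) [RHS](bigID G).
suff : (\sum_(h | ~~ G h) weight w h) * (4 * M) <= M.
  rewrite -ler_pdivlMr ?mulr_gt0 //.
  have -> : M / (4 * M) = 4^-1 by field; rewrite gt_eqF.
  by lra.
apply: le_trans (noisy_variance (4 * r) c); rewrite -/w big_distrl /=.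
rewrite [leRHS](bigID G) /= -[leLHS]add0r lerD //.
  by apply: sumr_ge0 => h _; rewrite mulr_ge0 ?sqr_ge0.
apply: ler_sum => h; rewrite /G -ltNge => Gh; rewrite ler_wpM2l //.
rewrite sumrB sum_agree_sign sumr_const -(mulr_natl (4 * r)) -/M -sqrrN opprB.
set a : R := (agree c h)%:R in Gh *.
(* The sum of signs has mean [4 r M]; a failing [h] keeps it below [2 r^2 M], which is at most
   [2 r M]. *)
have dev : 2 * r * M <= M * (4 * r) - (2 * a - M).
  have : 0 <= r * M * (1 - 4 * r) by rewrite !mulr_ge0 //; lra.
  have : 0 <= r * M by rewrite mulr_ge0 // ltW.
  by move: Gh; rewrite mulrDl; lra.
have : (2 * r * M) ^+ 2 <= (M * (4 * r) - (2 * a - M)) ^+ 2.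
  by rewrite ler_sqr // nnegrE ?(le_trans _ dev) // !mulr_ge0 // ltW.
have : 4 * M <= (2 * r * M) ^+ 2.
  have -> : (2 * r * M) ^+ 2 = 4 * M * (r ^+ 2 * M) by ring.
  by rewrite ler_peMr // mulr_ge0 // ltW.
exact: le_trans.
Qed.

Definition flip_at z0 h : {ffun Q -> bool} :=
  [ffun z => if z == z0 then ~~ h z else h z].
Definition flip_all h : {ffun Q -> bool} := [ffun z => ~~ h z].

Lemma flip_at_inj z0 : injective (flip_at z0).
Proof.
apply: (can_inj (g := flip_at z0)) => h; apply/ffunP => z; rewrite !ffunE.
by case: (z == z0); rewrite ?negbK.
Qed.

Lemma flip_all_inj : injective flip_all.
Proof.
by apply: (can_inj (g := flip_all)) => h; apply/ffunP => z; rewrite !ffunE negbK.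
Qed.

Lemma agree_flip_all c h : (agree c (flip_all h) + agree c h = #|Q|)%N.
Proof.
rewrite /agree -(cardC [pred z | h z == c z]) addnC; congr (_ + _)%N.
by apply: eq_card => z; rewrite !inE /= ffunE; case: (h z); case: (c z).
Qed.

(** The agreement moves by exactly one; this breaks a tie at the median. *)
Lemma agree_flip_at z0 c h : agree c (flip_at z0 h) <> agree c h.
Proof.
rewrite /agree (cardD1 z0) [RHS](cardD1 z0) !inE /= ffunE eqxx.
set n := #|_|; set m := #|_|.
have -> : n = m.
  apply: eq_card => z; rewrite !inE /= ffunE.
  by case: (z == z0).
by case: (h z0); case: (c z0) => /=; lia.
Qed.

(* The median is exceeded by one of [h], [h] with one bit flipped, and their
   complements. *)
Lemma uniform_agree_gt n c :
  #|Q| = n.*2 -> (0 < n)%N ->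
  4^-1 <= \sum_(h | (n < agree c h)%N) weight (noisy 0 c) h.
Proof.
move=> Qn n0; have /card_gt0P[z0 _] : (0 < #|Q|)%N by lia.
pose I h : R := (n < agree c h)%N%:R.
set k : R := 2^-1 ^+ #|Q|.
have wk h : weight (noisy 0 c) h = k.
  by rewrite /weight /noisy; under eq_bigr do rewrite mul0r addr0 mul1r;
     rewrite prodr_const.
have -> : \sum_(h | (n < agree c h)%N) weight (noisy 0 c) h = \sum_h k * I h.
  rewrite big_mkcond; apply: eq_bigr => h _; rewrite wk /I.
  by case: ltnP; rewrite ?mulr1 ?mulr0.
set S := \sum_h _.
have S1 : \sum_h k * I (flip_at z0 h) = S.
  by rewrite /S [RHS](reindex_inj (@flip_at_inj z0)).
have S2 : \sum_h k * I (flip_all h) = S.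
  by rewrite /S [RHS](reindex_inj flip_all_inj).
have S3 : \sum_h k * I (flip_all (flip_at z0 h)) = S.
  by rewrite -S2 [RHS](reindex_inj (@flip_at_inj z0)).
have k0 : 0 <= k by rewrite exprn_ge0 // invr_ge0.
(* The flips preserve the uniform measure, so each of the four events has weight [S]; pointwise at
   least one of them occurs. *)
suff : 1 <= S + S + S + S by lra.
rewrite -{1}S1 -{1}S2 -{1}S3 /S -!big_split /= -(sum_noisy 0 c).
apply: ler_sum => h _; rewrite wk -!mulrDr ler_peMr // /I -!natrD ler1n.
have := agree_flip_all c h; have := agree_flip_all c (flip_at z0 h).
have := @agree_flip_at z0 c h.
by lia.
Qed.

End Noise.

(** * Averaging over random functions and the union bound *)

Section Counting.
Variables (R : realType) (X Y Q : finType).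

(** Giving each point of [S] its own indicator and one factor [#|Y|] makes the summand a product
    over [x]; every point, inside [S] or not, then contributes [#|Y|]. *)
Lemma sum_agree_on (F : X -> Y) (S : {set X}) :
  \sum_(g : {ffun X -> Y}) ([forall x in S, F x == g x]%:R : R)
    * #|Y|%:R ^+ #|S| = #|Y|%:R ^+ #|X|.
Proof.
pose v x y : R := if x \in S then (F x == y)%:R * #|Y|%:R else 1.
transitivity (\sum_(g : {ffun X -> Y}) \prod_x v x (g x)).
  apply: eq_bigr => g _; rewrite -big_mkcond big_split /= prodr_const.
  congr (_ * _); have [/forall_inP all|] := boolP [forall x in S, F x == g x].
    by rewrite big1 // => x xS; rewrite all.
  by case/forall_inPn => x xS /negPf Fx; rewrite (bigD1 x) //= Fx mul0r.
rewrite -bigA_distr_bigA /= -prodr_const; apply: eq_bigr => x _; rewrite /v.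
case: (x \in S); last by rewrite sumr_const.
rewrite -big_distrl (bigD1 (F x)) //= eqxx big1 ?addr0 ?mul1r // => y /negPf.
by rewrite eq_sym => ->.
Qed.

(** Each query costs a factor [1 + d] to make [h] uniform and independent of [g]. For fixed [h] the
    answers are then a fixed function of [x], and [sum_agree_on] applies. *)
Lemma noisy_success_le (Con : (X -> Y) -> Q -> bool) (p : X -> oracle_proc Q Y)
    (q : nat) (d : R) (S : {set X}) :
  0 <= d <= 1 -> (forall h x, nqueries h (p x) <= q)%N ->
  (\sum_(g : {ffun X -> Y}) \sum_h weight (noisy d (Con g)) h *
     [forall x in S, run h (p x) == g x]%:R) * #|Y|%:R ^+ #|S| <=
  (1 + d) ^+ (#|S| * q) * #|Y|%:R ^+ #|X|.
Proof.
move=> d01 hq; have /andP[d0 d1] := d01.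
set K := (1 + d) ^+ _; pose u (z : Q) (b : bool) : R := 2^-1.
have K0 : 0 <= K by rewrite exprn_ge0 // addr_ge0.
have u0 h : 0 <= weight u h by apply: weight_ge0 => ? ?; rewrite invr_ge0.
have all_forall (g : {ffun X -> Y}) (h : {ffun Q -> bool}) :
    run h (all_proc (fun x y => y == g x) p (enum S)) =
    [forall x in S, run h (p x) == g x].
  rewrite run_all_proc; apply/allP/forall_inP => H x xS; apply: H.
    by rewrite mem_enum.
  by rewrite mem_enum in xS.
have le_g (g : {ffun X -> Y}) :
    \sum_h weight (noisy d (Con g)) h * [forall x in S, run h (p x) == g x]%:R
    <= K * \sum_h weight u h * [forall x in S, run h (p x) == g x]%:R.
  under eq_bigr do rewrite -all_forall.
  apply: (le_trans (@run_change_of_measure _ _ _ _ (fun b : bool => b%:R)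
    (1 + d) _ u _ _ _ _)) => //.
  - by rewrite lerDl.
  - by move=> z b; rewrite noisy_ge0 // noisy_le.
  - by move=> z; rewrite noisy_mass /u; field.
  rewrite big_distrr; apply: ler_sum => h _ /=; rewrite all_forall mulrCA.
  rewrite ler_wpM2r ?mulr_ge0 // /K ler_weXn2l ?lerDl // cardE.
  exact: nqueries_all_proc.
apply: (@le_trans _ _ ((\sum_(g : {ffun X -> Y}) K * \sum_h weight u h *
    [forall x in S, run h (p x) == g x]%:R) * #|Y|%:R ^+ #|S|)).
  by rewrite ler_wpM2r ?exprn_ge0 // ler_sum.
rewrite -big_distrr -mulrA ler_wpM2l // exchange_big /= big_distrl /=.
under eq_bigr do rewrite -big_distrr -mulrA big_distrl /= sum_agree_on.
rewrite -big_distrl /= sum_weight big1 ?mul1r // => z _.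
by rewrite /u; field.
Qed.

Lemma subset_of_card (A : {pred X}) (s : nat) :
  (s <= #|A|)%N -> exists2 S : {set X}, #|S| = s & {subset S <= A}.
Proof.
move=> sA; exists [set x in take s (enum A)].
  rewrite cardsE; have /card_uniqP -> := take_uniq s (enum_uniq A).
  by rewrite size_takel // -cardE.
by move=> x; rewrite inE => /mem_take; rewrite mem_enum.
Qed.

(** The expected number of successful pairs [(a, S)] with [#|S| = s] is bounded from both sides: a
    good [h] has at least one, and [noisy_success_le] controls each pair. Summing over all pairs
    handles advice that depends on [g] and [h]. *)
Lemma advice_union_bound (T : finType) (Con : (X -> Y) -> Q -> bool)
    (p : T -> X -> oracle_proc Q Y) (q s : nat) (d : R)
    (good : {ffun X -> Y} -> pred {ffun Q -> bool}) :
  0 <= d <= 1 -> (0 < #|Y|)%N ->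
  (forall h a x, nqueries h (p a x) <= q)%N ->
  (forall g h, good g h ->
     exists a, (s <= #|[pred x | run h (p a x) == g x]|)%N) ->
  (forall g, 4^-1 <= \sum_(h | good g h) weight (noisy d (Con g)) h) ->
  #|Y|%:R ^+ s <= 4 * #|T|%:R * 'C(#|X|, s)%:R * (1 + d) ^+ (s * q).
Proof.
move=> d01 Y0 hq hgood hprob.
set N : R := #|Y|%:R ^+ #|X|.
have Y0' : 0 < #|Y|%:R :> R by rewrite ltr0n.
have N0 : 0 < N by rewrite exprn_gt0.
have w0 g h : 0 <= weight (noisy d (Con g)) h.
  by apply: weight_ge0 => z b; apply: noisy_ge0.
pose E a (S : {set X}) (g : {ffun X -> Y}) (h : {ffun Q -> bool}) : R :=
  [forall x in S, run h (p a x) == g x]%:R.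
have low : 4^-1 * N <= \sum_(g : {ffun X -> Y}) \sum_h
    weight (noisy d (Con g)) h * \sum_a \sum_(S : {set X} | #|S| == s) E a S g h.
  rewrite /N -natrX -card_ffun -sumr_const mulr_sumr /=.
  rewrite [leLHS](eq_bigl xpredT) //; apply: ler_sum => g _; rewrite mulr1.
  apply: le_trans (hprob g) _; rewrite big_mkcond /=; apply: ler_sum => h _.
  have E0 a S : 0 <= E a S g h by rewrite ler0n.
  case: ifP => [/hgood [a sa]|_]; last first.
    by rewrite mulr_ge0 // sumr_ge0 // => a _; rewrite sumr_ge0.
  rewrite ler_peMr //; have [S /eqP cS SA] := subset_of_card sa.
  rewrite (bigD1 a) //= (bigD1 S) //=.
  have -> : E a S g h = 1.
    by rewrite /E; case: forall_inP => // -[] x /SA.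
  by rewrite -addrA lerDl addr_ge0 // ?sumr_ge0 // => b _; rewrite sumr_ge0.
have up : (\sum_(g : {ffun X -> Y}) \sum_h
    weight (noisy d (Con g)) h * \sum_a \sum_(S : {set X} | #|S| == s) E a S g h)
      * #|Y|%:R ^+ s <= #|T|%:R * 'C(#|X|, s)%:R * ((1 + d) ^+ (s * q) * N).
  under eq_bigr do under eq_bigr do rewrite mulr_sumr.
  under eq_bigr do rewrite exchange_big.
  rewrite exchange_big /= mulr_suml.
  rewrite -mulrA mulr_natl -[leRHS]sumr_const [leRHS](eq_bigl xpredT) //.
  apply: ler_sum => a _.
  under eq_bigr do under eq_bigr do rewrite mulr_sumr.
  under eq_bigr do rewrite exchange_big.
  rewrite exchange_big /= mulr_suml.
  rewrite mulr_natl -card_draws -[leRHS]sumr_const.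
  rewrite [leRHS](eq_bigl (fun S : {set X} => #|S| == s)); last first.
    by move=> S; rewrite inE.
  apply: ler_sum => S /eqP <-; exact: noisy_success_le.
have := ler_wpM2r (exprn_ge0 s (ltW Y0')) low.
move=> /le_trans/(_ up); rewrite mulrAC [leRHS]mulrA ler_pM2r //.
by lra.
Qed.

End Counting.

(** * Elementary estimates for binomials and powers *)

Lemma ffact_le_exp n m : (n ^_ m <= n ^ m)%N.
Proof.
elim: m => // m IH; rewrite ffactnSr expnSr leq_mul //; exact: leq_subr.
Qed.

(** The top [m] factors of the factorial all exceed [m]. *)
Lemma exp_le_fact_double m : (m ^ m <= (m.*2)`!)%N.
Proof.
suff H j : (m ^ j * m`! <= (m + j)`!)%N.
  by rewrite -addnn; apply: leq_trans (H m); rewrite leq_pmulr ?fact_gt0.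
elim: j => [|j IH]; first by rewrite mul1n addn0.
rewrite addnS factS expnS -mulnA leq_mul //; lia.
Qed.

(** A weaker, integral substitute for the bound [(e n / s)^s] on the binomial, with [s = 2 m]; the
    gain [m ^ m] drives the final contradiction. *)
Lemma bin_exp_le n m : ('C(n, m.*2) * m ^ m <= n ^ m.*2)%N.
Proof.
apply: leq_trans (ffact_le_exp n m.*2); rewrite -bin_ffact.
by rewrite leq_mul2l exp_le_fact_double orbT.
Qed.

Section Bernoulli.
Variable R : realType.

Lemma bernoulli (x : R) n : -1 <= x -> 1 + n%:R * x <= (1 + x) ^+ n.
Proof.
move=> x1; elim: n => [|n IH]; first by rewrite expr0 mul0r addr0.
rewrite exprSr; apply: le_trans (ler_wpM2r _ IH); last by lra.
have : 0 <= n%:R * (x * x) by rewrite mulr_ge0 // -expr2 sqr_ge0.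
by rewrite -natr1; lra.
Qed.

(** Bernoulli gives [(1 - r/2)^q >= 1/2], hence [(1 + r/2)^q <= 2] as the two bases multiply to at
    most 1. The exponent 8 comes from [1 + 4 r <= (1 + r/2)^8]. *)
Lemma exp_1D_4r_le (r : R) q : 0 <= r <= 1 -> r * q%:R <= 1 ->
  (1 + 4 * r) ^+ q <= 2 ^+ 8.
Proof.
move=> /andP[r0 r1] rq.
have h1 : 2^-1 <= (1 - r / 2) ^+ q.
  by apply: le_trans (@bernoulli (- (r / 2)) q _); lra.
have h2 : (1 + r / 2) ^+ q <= 2.
  have : (1 + r / 2) ^+ q * (1 - r / 2) ^+ q <= 1.
    rewrite -exprMn exprn_ile1 //; have := sqr_ge0 r; last by lra.
    by move=> _; rewrite mulr_ge0; lra.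
  have : 0 <= (1 + r / 2) ^+ q by rewrite exprn_ge0; lra.
  by nra.
have h3 : 1 + 4 * r <= (1 + r / 2) ^+ 8.
  by apply: le_trans (@bernoulli (r / 2) 8 _); lra.
apply: le_trans (_ : ((1 + r / 2) ^+ 8) ^+ q <= _).
  by rewrite lerXn2r // nnegrE ?exprn_ge0; lra.
by rewrite exprAC lerXn2r // nnegrE ?exprn_ge0 //; lra.
Qed.

End Bernoulli.

(** * Choice of parameters and the contradiction *)

Lemma card_bits m : #|{: bits m}| = (2 ^ m)%N.
Proof. by rewrite card_tuple card_bool. Qed.

(** The left side, at most [18 m + 2], collects the factors [4], [2^t] and [2^(8 s)] of the union
    bound for [s = 2 m]; the right side is the exponent of [m ^ m] for [m = 2^k]. *)
Lemma exponent_gap k m t : (24 <= k)%N -> (0 < m)%N -> (t <= m.*2)%N ->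
  (2 + t + 8 * m.*2 < k * m)%N.
Proof. by move=> k24; have := leq_mul k24 (leqnn m); lia. Qed.

Lemma good_noise_exists (R : realType) l' (eps : R) q :
  (0 < l')%N -> 0 <= Num.sqrt eps <= 4^-1 -> 0 < eps ->
  Num.sqrt eps * q%:R <= 1 ->
  exists d : R, [/\ 0 <= d <= 1, (1 + d) ^+ q <= 2 ^+ 8 &
    forall c : bits l' -> bool,
      4^-1 <= \sum_(h | (2^-1 + eps) * (2 ^ l')%:R <= (agree c h)%:R)
                weight (noisy d c) h].
Proof.
rewrite -card_bits; move=> l'0 /andP[r0 r4] eps0 rq; set r := Num.sqrt eps in r0 r4 rq.
have <- : r ^+ 2 = eps by rewrite sqr_sqrtr // ltW.
case: (leP 1 (r ^+ 2 * #|{: bits l'}|%:R)) => rM.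
  exists (4 * r); split; first by lra.
    by apply: exp_1D_4r_le; lra.
  by move=> c; apply: noisy_agree_ge => //; rewrite r0.
exists 0; split; first by lra.
  by rewrite addr0 expr1n exprn_ege1 //; lra.
move=> c; have Mn : #|{: bits l'}| = (2 ^ l'.-1).*2.
  by rewrite card_bits -{1}(prednK l'0) expnS mul2n.
apply: le_trans (uniform_agree_gt R c Mn _) _; first by rewrite expn_gt0.
rewrite big_mkcond [leRHS]big_mkcond /=; apply: ler_sum => h _.
have w0 : 0 <= weight (noisy (0 : R) c) h.
  by apply: weight_ge0 => z b; apply: noisy_ge0; lra.
case: ltnP => A; last by case: ifP.
suff -> : (2^-1 + r ^+ 2) * #|{: bits l'}|%:R <= (agree c h)%:R :> R by [].
(* As [eps 2^l' < 1], one agreement above the median already suffices. *)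
have : (2 ^ l'.-1)%N%:R + 1 <= (agree c h)%:R :> R by rewrite natr1 ler_nat.
move: rM; rewrite mulrDl Mn -mul2n natrM; lra.
Qed.

Theorem theorem5p2 (R : realType) :
  exists beta c : R, 0 < beta /\ 1 < c /\
  exists l0 l0' : nat, forall l l' : nat, (l0 <= l)%N -> (l0' <= l')%N ->
  forall (eps rho : R) (t q : nat),
    0 < eps ->
    t%:R <= (2 : R) `^ (l%:R / 5) ->
    (2 : R) `^ (- (l%:R / 3)) <= rho ->
  forall (Con : construction l l') (Red : reduction l l' t),
    hardcore_bb_proof rho eps q Con Red ->
    1 / eps `^ beta - c * (t%:R + l%:R) <= q%:R.
Proof.
exists 2^-1, 2; split; first by lra.
split; first by lra.
exists 40%N, 1%N => l l' l40 l'1.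
(* With [s = 2^(k+1)], the last two bounds yield [t <= s] and [s <= rho 2^l]; [l >= 40] ensures
   [24 <= k]. *)
have [k [k24 kl5 kl3]] : exists k,
    [/\ 24 <= k, l <= 5 * k.+1 & 3 * k.+1 <= 2 * l]%N.
  by exists ((2 * l) %/ 3).-1; split; lia.
move=> eps rho t q eps0 tle rhole Con Red [hq hred].
rewrite leNgt; apply/negP; rewrite powR12_sqrt ?ltW // => hlt.
set r := Num.sqrt eps in hlt.
have r0 : 0 < r by rewrite sqrtr_gt0.
(* This yields both [r q <= 1] and, since [l >= 40], [r <= 1/4]. *)
have rlt : r * (q%:R + 2 * (t%:R + l%:R)) < 1.
  by rewrite mulrC -ltr_pdivlMr //; lra.
have lR : 40 <= l%:R :> R by rewrite ler_nat.
have rl : r * 40 <= r * l%:R by rewrite ler_pM2l.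
have rt : 0 <= r * t%:R by rewrite mulr_ge0 // ltW.
have rq : 0 <= r * q%:R by rewrite mulr_ge0 // ltW.
have [||d [d01 dq hprob]] := @good_noise_exists R l' eps q l'1 _ eps0.
- by rewrite -/r; lra.
- by rewrite -/r; lra.
pose m := (2 ^ k)%N; pose s := m.*2.
have sE : s = (2 ^ k.+1)%N by rewrite /s /m expnS mul2n.
have sR : s%:R = (2 : R) `^ (k.+1)%:R by rewrite sE powR_mulrn // natrX.
have ts : (t <= s)%N.
  rewrite -(ler_nat R) sR; apply: le_trans tle _.
  rewrite ler_powR //; first by lra.
  by move: kl5; rewrite -(ler_nat R) natrM; lra.
have srho : s%:R <= rho * (2 ^ l)%N%:R.
  rewrite natrX -powR_mulrn // sR; apply: le_trans (ler_wpM2r (powR_ge0 _ _) rhole).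
  rewrite -powRD; last by apply/implyP; lra.
  rewrite ler_powR //; first by lra.
  by move: kl3; rewrite -(ler_nat R) !natrM; lra.
have := @advice_union_bound R _ _ _ _ Con (fun a x => Red x a) q s d
  (fun g h => (2^-1 + eps) * #|{: bits l'}|%:R <= (agree (Con g) h)%:R) d01.
rewrite !card_bits expn_gt0 => /(_ isT) H.
have {H} := H (fun h a x => hq h x a).
move=> /(_ _ (fun g => hprob (Con g))) H.
have {H} : (2 ^ l)%N%:R ^+ s <=
    4 * (2 ^ t)%N%:R * 'C(2 ^ l, s)%:R * (1 + d) ^+ (s * q) :> R.
  apply: H => g h hg; have [|a ha] := hred g h.
    by rewrite /prU ler_pdivlMr card_bits // ltr0n expn_gt0.
  exists a; rewrite -(ler_nat R); apply: le_trans srho _.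
  by move: ha; rewrite /prU card_bits ler_pdivlMr // ltr0n expn_gt0.
move=> H.
have {H} Hs : ((2 ^ l) ^ s <= 4 * 2 ^ t * 'C(2 ^ l, s) * 2 ^ (8 * s))%N.
  rewrite -(ler_nat R) natrX; apply: le_trans H _.
  rewrite !natrM ler_wpM2l ?mulr_ge0 // natrX mulnC !exprM lerXn2r //.
    by rewrite nnegrE exprn_ge0 //; lra.
  by rewrite nnegrE exprn_ge0.
have m0 : (0 < m)%N by rewrite expn_gt0.
(* Multiplying the union bound by [m ^ m = 2^(k m)] lets [bin_exp_le] absorb the binomial into
   [(2^l)^s], which then cancels. *)
have : (2 ^ (k * m) <= 2 ^ (2 + t + 8 * s))%N.
  have L0 : (0 < (2 ^ l) ^ s)%N by rewrite !expn_gt0.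
  rewrite -(leq_pmul2r L0) expnM -/m.
  apply: leq_trans (leq_mul (leqnn (m ^ m)) Hs) _.
  have := bin_exp_le (2 ^ l) m; rewrite -/s.
  move=> /(leq_mul (leqnn (2 ^ (2 + t + 8 * s)))); apply: leq_trans.
  have mulACA (e a C b : nat) : (e * (4 * a * C * b) = 4 * a * b * (C * e))%N.
    by ring.
  by rewrite mulACA !expnD.
by rewrite leq_exp2l // leqNgt exponent_gap.
Qed.
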